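(* For any lattice $\mathcal{L} \subset \mathbb{R}^n$ and any two vectors $\mathbf{x}, \mathbf{y} \in \mathbb{R}^n$, all of the following hold: \[ \text{(a)}\quad f_{\mathcal{L}}(\mathbf{x})^2 f_{\mathcal{L}}(\mathbf{y})^2 \leq f_{\mathcal{L}}(\mathbf{x} + \mathbf{y})\,f_{\mathcal{L}}(\mathbf{x} - \mathbf{y}); \] \[ \text{(b)}\quad f_{\mathcal{L}}(\mathbf{x})^4 \leq f_{\mathcal{L}}(2\mathbf{x}); \] \[ \text{(c)}\quad f_{\mathcal{L}}(\mathbf{x})f_{\mathcal{L}}(\mathbf{y}) \leq \big(f_{\mathcal{L}}(\mathbf{x} + \mathbf{y}) + f_{\mathcal{L}}(\mathbf{x} - \mathbf{y})\big)/2; \] \[ \text{(d)}\quad \mathbb{E}[\cos(2\pi \langle\mathbf{w}, \mathbf{x}\rangle)]^2\,\mathbb{E}[\cos(2\pi \langle\mathbf{w}, \mathbf{y}\rangle)]^2 \leq \mathbb{E}[\cos(2\pi \langle\mathbf{w}, \mathbf{x}\rangle)\cos(2\pi \langle\mathbf{w}, \mathbf{y}\rangle)]^2 - \mathbb{E}[\sin(2\pi \langle\mathbf{w}, \mathbf{x}\rangle)\sin(2\pi \langle\mathbf{w}, \mathbf{y}\rangle)]^2; \] \[ \text{(e)}\quad \mathbb{E}[\cos(2\pi \langle\mathbf{w}, \mathbf{x}\rangle)]\,\mathbb{E}[\cos(2\pi \langle\mathbf{w}, \mathbf{y}\rangle)] \leq \mathbb{E}[\cos(2\pi \langle\mathbf{w},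 \mathbf{x}\rangle)\cos(2\pi \langle\mathbf{w}, \mathbf{y}\rangle)]. \] In (d) and (e) every expectation is over $\mathbf{w}\sim D_{\mathcal{L}}$.
   Context: A lattice $\mathcal{L}\subset\mathbb{R}^n$ is the set of all integer linear combinations of $n$ linearly independent vectors of $\mathbb{R}^n$. For $\mathbf{x}\in\mathbb{R}^n$, $\rho(\mathbf{x}) = \exp(-\pi \|\mathbf{x}\|^2)$ with $\|\cdot\|$ the Euclidean norm, and for a discrete set $A\subset\mathbb{R}^n$, $\rho(A) = \sum_{\mathbf{w}\in A}\rho(\mathbf{w})$. The periodic Gaussian function is $f_{\mathcal{L}}(\mathbf{x}) = \rho(\mathcal{L}+\mathbf{x})/\rho(\mathcal{L})$. The discrete Gaussian distribution $D_{\mathcal{L}}$ is the probability distribution on $\mathcal{L}$ assigning probability $\rho(\mathbf{w})/\rho(\mathcal{L})$ to each $\mathbf{w}\in\mathcal{L}$. The notation $\mathbb{E}[X]^2$ means $(\mathbb{E}[X])^2$, and $\langle\cdot,\cdot\rangle$ is the standard inner product. *)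

(* Defs.v *)
From HB Require Import structures.
From mathcomp Require Import all_boot all_order all_algebra.
From mathcomp Require Import all_classical all_reals all_analysis.
From mathcomp Require Import finmap ring lra.
Set Implicit Arguments.
Unset Strict Implicit.
Unset Printing Implicit Defensive.
Import Order.TTheory GRing.Theory Num.Theory.
Import numFieldNormedType.Exports.
Local Open Scope classical_set_scope.
Local Open Scope ring_scope.

Section Gaussian.
Context {R : realType} {n : nat}.
Implicit Types (x y w : 'rV[R]_n) (A : set 'rV[R]_n).

Definition dotv x y : R := \sum_(i < n) x 0 i * y 0 i.

(* The library norm `|x| on 'rV[R]_n is the sup norm, hence this definition. *)
Definition enorm x : R := Num.sqrt (dotv x x).

Definition rho x : R := expR (- pi * enorm x ^+ 2).

(* The sum of nonnegative terms is taken in \bar R.  It is finite on translates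
   of lattices (rho_translate_fin below), the only sets to which rho_set is
   applied, so that [fine] loses nothing there. *)
Definition rho_set A : R := fine (\esum_(w in A) (rho w)%:E).

Definition translate A x : set 'rV[R]_n := [set w + x | w in A].

Definition is_lattice A : Prop :=
  exists2 B : 'M[R]_n, row_free B &
    A = [set \sum_(i < n) (c i)%:~R *: row i B | c in [set: 'I_n -> int]].

End Gaussian.

Record lattice (R : realType) (n : nat) := Lattice {
  lattice_set :> set 'rV[R]_n;
  lattice_setP : is_lattice lattice_set }.

Definition periodic_gaussian {R : realType} {n : nat} (L : lattice R n)
    (x : 'rV[R]_n) : R :=
  rho_set (translate L x) / rho_set L.

Section Summability.
Context {R : realType}.
Local Open Scope ereal_scope.

Lemma le_esum_subset (T : choiceType) (A B : set T) (a : T -> \bar R) :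
  A `<=` B -> \esum_(i in A) a i <= \esum_(i in B) a i.
Proof.
move=> AB; apply: ge_ereal_sup => _ [F [finF FA] <-].
by apply: ereal_sup_ubound; exists F => //; split => //; exact: subset_trans AB.
Qed.

Lemma le_esumZl (T : choiceType) (A : set T) (a : T -> \bar R) (k : R) :
  (0 <= k)%R -> (forall i, 0 <= a i) ->
  \esum_(i in A) (k%:E * a i) <= k%:E * \esum_(i in A) a i.
Proof.
move=> k0 a0; apply: ge_ereal_sup => _ [F [finF FA] <-].
rewrite fsbig_finite//= -ge0_sume_distrr//; apply: lee_wpmul2l; rewrite ?lee_fin//.
by rewrite -fsbig_finite//; apply: ereal_sup_ubound; exists F.
Qed.

Lemma esumZl (T : choiceType) (A : set T) (a : T -> \bar R) (k : R) :
  (0 < k)%R -> (forall i, 0 <= a i) ->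
  \esum_(i in A) (k%:E * a i) = k%:E * \esum_(i in A) a i.
Proof.
move=> k0 a0; apply/le_anti/andP; split; first exact/le_esumZl/a0/ltW.
have ki : (0 <= k^-1)%R by rewrite invr_ge0 ltW.
have := @le_esumZl T A (fun i => k%:E * a i) _ ki
  (fun i => mule_ge0 (ltW k0 : 0 <= k%:E) (a0 i)).
under eq_esum => i _ do rewrite muleA -EFinM mulVf ?gt_eqF// mul1e.
move=> /(lee_wpmul2l (ltW k0 : 0 <= k%:E)).
by rewrite muleA -EFinM mulfV ?gt_eqF// mul1e.
Qed.

Lemma esum_int_geometric_fin (q : R) : (0 < q)%R -> (q < 1)%R ->
  \esum_(z in [set: int]) (q ^+ `|z|%N)%:E < +oo.
Proof.
move=> q0 q1.
have S : \esum_(i in [set: nat]) (q ^+ i)%:E < +oo.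
  rewrite -nneseries_esumT; last by move=> i; rewrite lee_fin exprn_ge0 ?ltW.
  rewrite [X in X < _](_ : _ = ((1 - q)^-1)%:E) ?ltry//.
  apply: cvg_lim => //.
  have -> : (fun m => \sum_(0 <= i < m) (q ^+ i)%:E) = EFin \o series (geometric 1%R q).
    by apply/funext => m /=; rewrite /series /= sumEFin;
      congr (_%:E); apply: eq_bigr => i _; rewrite /geometric /= mul1r.
  apply: cvg_EFin; first by near=> m.
  have := @cvg_geometric_series R 1 q; rewrite ger0_norm ?ltW// mul1r.
  by move=> /(_ q1).
have h0 z : 0 <= (q ^+ `|z|%N)%:E by rewrite lee_fin exprn_ge0 ?ltW.
rewrite (esumID [set Posz i | i in [set: nat]])//.
apply: lte_add_pinfty.
  rewrite setTI esum_image//.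
  by move=> i j _ _ [].
rewrite setTI; apply: le_lt_trans S.
apply: (@le_trans _ _ (\esum_(z in [set Negz i | i in [set: nat]]) (q ^+ `|z|%N)%:E)).
  apply: le_esum_subset => -[m|m] /= H; last by exists m.
  by exfalso; apply: H; exists m.
rewrite esum_image; last by move=> i j _ _ [].
apply: le_esum => i _; rewrite lee_fin /= exprS.
by rewrite ler_piMl ?exprn_ge0 ?ltW.
Unshelve. all: by end_near. Qed.

Lemma esum_finType (T : finType) (a : T -> \bar R) : (forall i, 0 <= a i) ->
  \esum_(i in [set: T]) a i = \sum_i a i.
Proof.
move=> a0; rewrite esum_fset; [|exact: finite_finset|by move=> i _; exact: a0].
rewrite -[RHS]big_enum /= [RHS]fsbig_seq ?enum_uniq//; apply: eq_fsbigl.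
by apply/seteqP; split=> i //= _; rewrite mem_enum.
Qed.

Lemma esum_prod_fin (n : nat) (h : int -> R) : (forall z, 0 <= h z)%R ->
  \esum_(z in [set: int]) (h z)%:E < +oo ->
  \esum_(c in [set: {ffun 'I_n -> int}]) (\prod_(i < n) h (c i))%R%:E < +oo.
Proof.
move=> h0 hfin; set S := \esum_(z in _) _ in hfin.
have S0 : 0 <= S by apply: esum_ge0 => z _; rewrite lee_fin.
have Sfin : S \is a fin_num by rewrite ge0_fin_numE.
apply: (@le_lt_trans _ _ ((fine S) ^+ n)%:E); last exact: ltry.
apply: ge_ereal_sup => _ [F [finF _] <-].
pose s : seq int := undup (flatten [seq codom c | c : {ffun 'I_n -> int} <- enum_fset (fset_set F)]).
pose e (g : {ffun 'I_n -> seq_sub s}) : {ffun 'I_n -> int} := [ffun i => val (g i)].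
have p0 c : 0 <= (\prod_(i < n) h (c i))%R%:E by rewrite lee_fin prodr_ge0.
have e_inj : injective e.
  move=> g g' /ffunP E; apply/ffunP => i; apply: val_inj.
  by have := E i; rewrite !ffunE.
have Fe : F `<=` [set e g | g in [set: {ffun 'I_n -> seq_sub s}]].
  move=> c Fc.
  have cs i : c i \in s.
    rewrite mem_undup; apply/flattenP; exists (codom c); last exact: codom_f.
    by apply/mapP; exists c => //; have := mem_set Fc; rewrite -in_fset_set.
  exists [ffun i => SeqSub (cs i)] => //.
  by apply/ffunP => i; rewrite !ffunE.
rewrite -esum_fset//.
apply: (le_trans (le_esum_subset _ Fe)).
rewrite esum_image; last by move=> g g' _ _; exact: e_inj.
rewrite esum_finType; last by move=> g; apply: p0.
rewrite sumEFin lee_fin.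
under eq_bigr => g _ do under eq_bigr => i _ do rewrite ffunE.
rewrite -(bigA_distr_bigA (fun _ z => h (val z))) /= prodr_const card_ord.
rewrite lerXn2r ?nnegrE ?sumr_ge0 ?fine_ge0//.
rewrite -lee_fin fineK// -sumEFin -esum_finType; last by move=> z; rewrite lee_fin.
rewrite -(@esum_image _ _ _ _ (fun z : seq_sub s => val z) (fun z => (h z)%:E)); last first.
  by move=> z z' _ _; exact: val_inj.
exact: le_esum_subset.
Qed.

End Summability.

Section GaussianSums.
Context {R : realType} {n : nat}.

Lemma dotv_ge0 (x : 'rV[R]_n) : 0 <= dotv x x.
Proof. by apply: sumr_ge0 => i _; rewrite -expr2 sqr_ge0. Qed.

Lemma rho_gt0 (x : 'rV[R]_n) : 0 < rho x.
Proof. exact: expR_gt0. Qed.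

Lemma rho_ge0 (x : 'rV[R]_n) : 0 <= rho x.
Proof. exact/ltW/rho_gt0. Qed.

Lemma lattice0 (L : lattice R n) : lattice_set L 0.
Proof.
case: (lattice_setP L) => B _ ->; exists (fun=> 0) => //.
by rewrite big1// => i _; rewrite scale0r.
Qed.

Lemma rho_coord_le (B : 'M[R]_n) (x : 'rV[R]_n) : row_free B ->
  exists k : R, 0 <= k /\ forall c : {ffun 'I_n -> int},
    rho (\sum_(i < n) (c i)%:~R *: row i B + x) <=
    k * \prod_(i < n) expR (-1) ^+ `|c i|%N.
Proof.
move=> rB; pose m : R := \sum_(j < n) \sum_(i < n) `|invmx B j i|.
have m0 : 0 <= m by apply: sumr_ge0 => j _; apply: sumr_ge0.
pose K : R := \sum_(j < n) (m ^+ 2 + m * `|x 0 j|).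
exists (expR K); split=> [|c]; first exact: expR_ge0.
set v := _ + x.
have Bc : \row_i (c i)%:~R = (v - x) *m invmx B.
  rewrite /v addrK; apply/(canRL (mulmxK _)); first by rewrite -row_free_unit.
  by rewrite mulmx_sum_row; apply: eq_bigr => i _; rewrite mxE.
have cE : \sum_(i < n) `|c i|%:~R <= \sum_(j < n) (`|v 0 j| + `|x 0 j|) * m.
  apply: (@le_trans _ _ (\sum_(i < n) \sum_(j < n)
      (`|v 0 j| + `|x 0 j|) * `|invmx B j i|)).
    apply: ler_sum => i _; have := congr1 (fun M : 'rV[R]_n => M 0 i) Bc.
    rewrite !mxE intr_norm => ->; apply: le_trans (ler_norm_sum _ _ _) _.
    apply: ler_sum => j _; rewrite normrM ler_wpM2r// !mxE.
    exact: ler_normB.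
  rewrite exchange_big /=; apply: ler_sum => j _.
  rewrite -mulr_sumr ler_wpM2l ?addr_ge0// /m [leRHS](bigD1 j)//= lerDl.
  by apply: sumr_ge0 => k _; apply: sumr_ge0.
have -> : \prod_(i < n) expR (-1) ^+ `|c i|%N = expR (- \sum_(i < n) `|c i|%:~R) :> R.
  rewrite -sumrN expR_sum; apply: eq_bigr => i _.
  by rewrite -expRM_natl mulrN1 -abszE.
rewrite -expRD /rho ler_expR sqr_sqrtr ?dotv_ge0// addrC -lerBlDr.
have pi1 : 1 <= pi :> R by apply: le_trans (pi_ge2 R); rewrite ler1n.
suff : \sum_(j < n) (`|v 0 j| + `|x 0 j|) * m <= pi * dotv v v + K by lra.
rewrite /dotv /K mulr_sumr -big_split /=; apply: ler_sum => j _.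
have : `|v 0 j| * m <= pi * (v 0 j * v 0 j) + m ^+ 2; last by lra.
have -> : v 0 j * v 0 j = `|v 0 j| ^+ 2 by rewrite real_normK ?num_real// expr2.
have : `|v 0 j| ^+ 2 <= pi * `|v 0 j| ^+ 2 by rewrite ler_peMl ?sqr_ge0.
by have := sqr_ge0 (`|v 0 j| - m); have := sqr_ge0 m; have := sqr_ge0 `|v 0 j|; lra.
Qed.

Lemma rho_translate_fin (L : lattice R n) (x : 'rV[R]_n) :
  (\esum_(w in translate L x) (rho w)%:E < +oo)%E.
Proof.
rewrite /translate; case: (lattice_setP L) => B rB ->.
pose f (c : {ffun 'I_n -> int}) := \sum_(i < n) (c i)%:~R *: row i B + x.
have -> : [set w + x | w in [set \sum_(i < n) (c i)%:~R *: row i B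
    | c in [set: 'I_n -> int]]] = [set f c | c in [set: {ffun 'I_n -> int}]].
  apply/seteqP; split=> [_ [_ [c _ <-] <-]|_ [c _ <-]].
    exists (finfun c) => //; rewrite /f; congr (_ + _).
    by apply: eq_bigr => i _; rewrite ffunE.
  by exists (\sum_(i < n) (c i)%:~R *: row i B) => //; exists c.
rewrite esum_image; last first.
  move=> c d _ _ /addIr E; apply/ffunP => i.
  have : \row_j (c j)%:~R = \row_j (d j)%:~R :> 'rV[R]_n.
    apply: (row_free_inj rB); rewrite !mulmx_sum_row.
    under eq_bigr => j _ do rewrite mxE.
    by under [RHS]eq_bigr => j _ do rewrite mxE.
  by move=> /rowP/(_ i); rewrite !mxE => /intr_inj.
have [k [k0 fk]] := rho_coord_le x rB.
apply: (@le_lt_trans _ _ (\esum_(c in [set: {ffun 'I_n -> int}])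
    (k%:E * (\prod_(i < n) expR (-1) ^+ `|c i|%N)%:E))%E).
  by apply: le_esum => c _; rewrite -EFinM lee_fin; exact: fk.
apply: (le_lt_trans (le_esumZl _ k0 _)).
  by move=> c; rewrite lee_fin prodr_ge0// => i _; rewrite exprn_ge0// expR_ge0.
apply: lte_mul_pinfty; rewrite ?lee_fin//.
apply: (@esum_prod_fin _ _ (fun z => expR (-1) ^+ `|z|%N)).
  by move=> z; rewrite exprn_ge0// expR_ge0.
by apply: esum_int_geometric_fin; rewrite ?expR_gt0// expR_lt1 ltrN10.
Qed.

Lemma translate0 (A : set 'rV[R]_n) : translate A 0 = A.
Proof.
apply/seteqP; split=> [_ [w Aw <-]|w Aw]; first by rewrite addr0.
by exists w => //; rewrite addr0.
Qed.

Lemma rho_lattice_fin (L : lattice R n) : (\esum_(w in L) (rho w)%:E < +oo)%E.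
Proof. by have := rho_translate_fin L 0; rewrite translate0. Qed.

Lemma rho_lattice_gt0 (L : lattice R n) : 0 < rho_set L.
Proof.
rewrite /rho_set fine_gt0// rho_lattice_fin andbT.
apply: (@lt_le_trans _ _ (rho (0 : 'rV[R]_n))%:E); first by rewrite lte_fin rho_gt0.
rewrite -[leLHS](@esum_set1 _ _ _ (fun w => (rho w)%:E)) ?lee_fin ?rho_ge0//.
by apply: le_esum_subset => _ ->; exact: lattice0.
Qed.

End GaussianSums.

(* The vectors of L, as a discrete measurable space. *)
Definition lattice_point {R : realType} {n : nat} (L : lattice R n) : Type :=
  {w : 'rV[R]_n | w \in lattice_set L}.

Definition lattice_vec {R : realType} {n : nat} (L : lattice R n)
  (w : lattice_point L) : 'rV[R]_n := val w.

Section DiscreteGaussian.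
Context {R : realType} {n : nat} (L : lattice R n).

HB.instance Definition _ := Choice.on (lattice_point L).
HB.instance Definition _ := isPointed.Build (lattice_point L)
  (exist _ 0 (mem_set (lattice0 L))).
HB.instance Definition _ := @isMeasurable.Build default_measure_display
  (lattice_point L) discrete_measurable discrete_measurable0
  discrete_measurableC discrete_measurableU.

Local Open Scope ereal_scope.

Definition discrete_gaussian (A : set (lattice_point L)) : \bar R :=
  \esum_(w in A) (rho (lattice_vec w) / rho_set L)%:E.

Let weight_ge0 (w : lattice_point L) :
  0 <= (rho (lattice_vec w) / rho_set L)%:E.
Proof. by rewrite lee_fin divr_ge0 ?rho_ge0// ltW// rho_lattice_gt0. Qed.

Let discrete_gaussian0 : discrete_gaussian set0 = 0.
Proof. exact: esum_set0. Qed.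

Let discrete_gaussian_ge0 A : 0 <= discrete_gaussian A.
Proof. exact: esum_ge0. Qed.

Let discrete_gaussian_sigma_additive :
  semi_sigma_additive discrete_gaussian.
Proof.
move=> F _ tF _; rewrite /discrete_gaussian nneseries_sum_bigcup//.
by apply: is_cvg_nneseries => i _ _; exact: discrete_gaussian_ge0.
Qed.

HB.instance Definition _ := isMeasure.Build _ _ _ discrete_gaussian
  discrete_gaussian0 discrete_gaussian_ge0 discrete_gaussian_sigma_additive.

Let discrete_gaussian_setT : discrete_gaussian setT = 1.
Proof.
have L0 := rho_lattice_gt0 L.
rewrite /discrete_gaussian.
under eq_esum => w _ do rewrite mulrC EFinM.
rewrite esumZl ?invr_gt0//; last by move=> w; rewrite lee_fin rho_ge0.
rewrite -(@esum_image _ _ _ _ (@lattice_vec _ _ L) (fun w => (rho w)%:E)); last first.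
  by move=> w w' _ _; exact: val_inj.
have -> : [set lattice_vec w | w in [set: lattice_point L]] = L.
  apply/seteqP; split=> [_ [w _ <-]|w Lw]; first exact/set_mem/(valP w).
  by exists (exist _ w (mem_set Lw)).
have E : \esum_(w in L) (rho w)%:E = (rho_set L)%:E.
  rewrite /rho_set fineK// ge0_fin_numE ?rho_lattice_fin//.
  by apply: esum_ge0 => w _; rewrite lee_fin rho_ge0.
by rewrite E -EFinM mulVf ?gt_eqF.
Qed.

HB.instance Definition _ := Measure_isProbability.Build _ _ _ discrete_gaussian
  discrete_gaussian_setT.

End DiscreteGaussian.

Arguments discrete_gaussian {R n} L A.

(* Main.v *)
(* Write F(z) for rho(L + z) or for the sum of rho(w) cos(2 pi <w, z>) over w
   in L.  In F(x) F(y), a sum over pairs (v, w) of lattice vectors, substitute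
   a = v + w and b = v - w: these range over the pairs with a = b mod 2L, and
   by the parallelogram law the Gaussian weights still factor.  Hence
   F(x) F(y) = sum_e g_e(x + y) g_e(x - y), where e ranges over L/2L.  In
   particular F(z) F(0) = sum_e g_e(z)^2 >= 0, and Cauchy-Schwarz gives
   F(x)^2 F(y)^2 <= F(0)^2 F(x + y) F(x - y).  The case rho(L + z) yields (a),
   (b), (c) and the cosine sum yields (d), (e), so that Poisson summation is
   not required. *)
Require Import Defs.
From mathcomp Require Import all_boot all_order all_algebra.
From mathcomp Require Import all_classical all_reals all_analysis.
From mathcomp Require Import ring lra zify.
Set Implicit Arguments.
Unset Strict Implicit.
Unset Printing Implicit Defensive.
Import Order.TTheory GRing.Theory Num.Theory.
Local Open Scope ring_scope.

(** * Inequalities that follow from a finite parallelogram decomposition *)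

Section FiniteInequalities.
Context {R : realType}.

(** Cauchy-Schwarz by Lagrange's identity: the double sum of squares is twice the defect. *)
Lemma sum_mul_sqr_le (I : finType) (a b : I -> R) :
  (\sum_i a i * b i) ^+ 2 <= (\sum_i a i ^+ 2) * \sum_i b i ^+ 2.
Proof.
have : 0 <= \sum_i \sum_j (a i * b j - a j * b i) ^+ 2.
  by apply: sumr_ge0 => i _; apply: sumr_ge0 => j _; exact: sqr_ge0.
have -> : \sum_i \sum_j (a i * b j - a j * b i) ^+ 2 =
    ((\sum_i a i ^+ 2) * (\sum_i b i ^+ 2) - (\sum_i a i * b i) ^+ 2) *+ 2.
  rewrite [(_ - _) *+ 2](_ : _ = (\sum_i a i ^+ 2) * (\sum_j b j ^+ 2)
      - (\sum_i a i * b i) * (\sum_j a j * b j) *+ 2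
      + (\sum_i b i ^+ 2) * (\sum_j a j ^+ 2)); last by ring.
  rewrite !big_distrlr -sumrMnl -sumrB -big_split; apply: eq_bigr => i _ /=.
  rewrite -sumrMnl -sumrB -big_split; apply: eq_bigr => j _ /=.
  by ring.
by rewrite pmulrn_lge0// subr_ge0.
Qed.

Lemma parallelogram_ge0 (V : zmodType) (I : finType) (F : V -> R)
    (g : I -> V -> R) :
  (forall x y, F x * F y = \sum_i g i (x + y) * g i (x - y)) ->
  forall x, 0 <= F x * F 0.
Proof.
move=> H x; rewrite H; apply: sumr_ge0 => i _.
by rewrite addr0 subr0 -expr2 sqr_ge0.
Qed.

(** Cauchy-Schwarz is applied to the families [g i (x + y)] and [g i (x - y)]; the hypothesis at
    second argument 0 turns the two sums of squares into [F (x + y) * F 0] and [F (x - y) * F 0]. *)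
Lemma parallelogram_le (V : zmodType) (I : finType) (F : V -> R)
    (g : I -> V -> R) :
  (forall x y, F x * F y = \sum_i g i (x + y) * g i (x - y)) ->
  forall x y, F x ^+ 2 * F y ^+ 2 <= F 0 ^+ 2 * (F (x + y) * F (x - y)).
Proof.
move=> H x y; have E z : F z * F 0 = \sum_i g i z ^+ 2.
  by rewrite H addr0 subr0; apply: eq_bigr => i _; rewrite expr2.
rewrite -exprMn (H x y); apply: (le_trans (sum_mul_sqr_le _ _)).
by rewrite -!E le_eqVlt; apply/orP; left; apply/eqP; ring.
Qed.

Lemma normalized_parallelogram (V : zmodType) (I : finType) (F : V -> R)
    (g : I -> V -> R) (f := fun x => F x / F 0) :
  0 < F 0 -> (forall x y, F x * F y = \sum_i g i (x + y) * g i (x - y)) ->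
  (forall x y, f x ^+ 2 * f y ^+ 2 <= f (x + y) * f (x - y)) /\
  (forall x y, f x * f y <= (f (x + y) + f (x - y)) / 2).
Proof.
move=> F0 H.
have f0 x : 0 <= f x.
  have := parallelogram_ge0 H x; rewrite pmulr_lge0// => /divr_ge0; apply.
  exact: ltW.
have fp x y : f x ^+ 2 * f y ^+ 2 <= f (x + y) * f (x - y).
  have : F x ^+ 2 * F y ^+ 2 / F 0 ^+ 4 <=
      F 0 ^+ 2 * (F (x + y) * F (x - y)) / F 0 ^+ 4.
    by rewrite ler_wpM2r ?invr_ge0 ?exprn_ge0 ?(ltW F0)// (parallelogram_le H).
  rewrite [leLHS](_ : _ = f x ^+ 2 * f y ^+ 2); last first.
    by rewrite /f; field; rewrite gt_eqF.
  rewrite [leRHS](_ : _ = f (x + y) * f (x - y))//.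
  by rewrite /f; field; rewrite gt_eqF.
split=> // x y.
(* Both sides are nonnegative, so it is enough to compare squares; AM-GM then bounds
   [f (x + y) * f (x - y)] by the square of the mean. *)
have m0 : 0 <= (f (x + y) + f (x - y)) / 2 by rewrite divr_ge0 ?addr_ge0.
have fxy0 : 0 <= f x * f y by rewrite mulr_ge0.
suff : (f x * f y) ^+ 2 <= ((f (x + y) + f (x - y)) / 2) ^+ 2.
  by rewrite ler_pXn2r// nnegrE.
rewrite exprMn; apply: le_trans (fp x y) _.
by have := sqr_ge0 (f (x + y) - f (x - y)); lra.
Qed.

End FiniteInequalities.

(** * Sums of nonnegative and of absolutely summable signed families *)

Section Sums.
Context {R : realType}.
Implicit Types T U : choiceType.

(** Since [a] is real, the relation asserts convergence together with the value. *)
Definition nonneg_sum T (p : T -> R) (a : R) : Prop :=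
  (forall i, 0 <= p i) /\ (\esum_(i in [set: T]) (p i)%:E = a%:E)%E.

(* Absolute convergence of a signed family, as a difference of summable
   nonnegative families: products, bijections and fibrations of sums then
   reduce to the corresponding facts for [esum]. *)
Definition has_sum T (f : T -> R) (s : R) : Prop := exists p q a b,
  [/\ nonneg_sum p a, nonneg_sum q b, f =1 p \- q & s = a - b].

(** A canonical value built from the positive and negative parts; it is meaningful only when both
    sums are finite, as [fine] sends [+oo] to 0. *)
Definition ssum T (f : T -> R) : R :=
  fine (\esum_(i in [set: T]) (f^\+ i)%:E) -
  fine (\esum_(i in [set: T]) (f^\- i)%:E).

Lemma eq_nonneg_sum T (p q : T -> R) a : p =1 q -> nonneg_sum p a ->
  nonneg_sum q a.
Proof. by move=> /funext ->. Qed.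

Lemma nonneg_sum_ge0 T (p : T -> R) a : nonneg_sum p a -> 0 <= a.
Proof.
by case=> p0 E; rewrite -lee_fin -E; apply: esum_ge0 => i _; rewrite lee_fin.
Qed.

Lemma nonneg_sum_unique T (p : T -> R) a b :
  nonneg_sum p a -> nonneg_sum p b -> a = b.
Proof. by move=> [_ E] [_]; rewrite E => -[]. Qed.

Lemma nonneg_sumD T (p q : T -> R) a b :
  nonneg_sum p a -> nonneg_sum q b -> nonneg_sum (p \+ q) (a + b).
Proof.
move=> [p0 pa] [q0 qb]; split=> [i|]; first by rewrite addr_ge0.
under eq_esum => i _ do rewrite EFinD.
by rewrite esumD ?pa ?qb// => i _; rewrite lee_fin.
Qed.

Lemma nonneg_sumZ T (p : T -> R) k a :
  0 <= k -> nonneg_sum p a -> nonneg_sum (fun i => k * p i) (k * a).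
Proof.
move=> k0 [p0 pa]; split=> [i|]; first exact: mulr_ge0.
move: k0; rewrite le_eqVlt => /predU1P[<-|k0].
  by rewrite mul0r esum1// => i _; rewrite mul0r.
under eq_esum => i _ do rewrite EFinM.
by rewrite esumZl// ?pa// => i; rewrite lee_fin.
Qed.

Lemma nonneg_sum_le T (p q : T -> R) a :
  (forall i, 0 <= p i <= q i) -> nonneg_sum q a ->
  nonneg_sum p (fine (\esum_(i in [set: T]) (p i)%:E)%E).
Proof.
move=> pq [q0 qa]; split=> [i|]; first by have /andP[] := pq i.
rewrite fineK// ge0_fin_numE; last first.
  by apply: esum_ge0 => i _; rewrite lee_fin; have /andP[] := pq i.
apply: (@le_lt_trans _ _ a%:E); last exact: ltry.
by rewrite -qa; apply: le_esum => i _; rewrite lee_fin; have /andP[] := pq i.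
Qed.

Lemma nonneg_sum_reindex T U (e : T -> U) (p : U -> R) a :
  bijective e -> nonneg_sum p a -> nonneg_sum (p \o e) a.
Proof.
move=> be [p0 pa]; split=> [i|]; first exact: p0.
by rewrite -pa (@reindex_esum _ _ _ [set: T]%classic _ e)// setTT_bijective.
Qed.

Lemma nonneg_sum_pair T U (p : T -> U -> R) (r : T -> R) a :
  (forall i, nonneg_sum (p i) (r i)) -> nonneg_sum r a ->
  nonneg_sum (fun t : T * U => p t.1 t.2) a.
Proof.
move=> pr [_ ra]; split=> [i|]; first by case: (pr i.1).
have -> : [set: T * U]%classic = ([set: T] `*`` fun=> [set: U])%classic.
  by apply/seteqP; split.
rewrite -(@esum_esum _ _ _ _ _ (fun i j => (p i j)%:E)).
  by rewrite -ra; apply: eq_esum => i _; case: (pr i).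
by move=> i j _ _; rewrite lee_fin; case: (pr i).
Qed.

Lemma nonneg_sum_mul T U (p : T -> R) (q : U -> R) a b :
  nonneg_sum p a -> nonneg_sum q b ->
  nonneg_sum (fun t : T * U => p t.1 * q t.2) (a * b).
Proof.
move=> pa qb; apply: (@nonneg_sum_pair _ _ (fun i j => p i * q j)
    (fun i => p i * b)) => [i|].
  by apply: nonneg_sumZ => //; case: pa.
apply: (@eq_nonneg_sum _ (fun i => b * p i)); first by move=> i; rewrite mulrC.
by rewrite mulrC; apply: nonneg_sumZ => //; exact: nonneg_sum_ge0 qb.
Qed.

Lemma nonneg_sum_finType (I : finType) (r : I -> R) :
  (forall i, 0 <= r i) -> nonneg_sum r (\sum_i r i).
Proof.
by move=> r0; split=> //; rewrite esum_finType ?sumEFin// => i; rewrite lee_fin.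
Qed.

Lemma eq_has_sum T (f g : T -> R) s : f =1 g -> has_sum f s -> has_sum g s.
Proof. by move=> /funext ->. Qed.

Lemma nonneg_has_sum T (p : T -> R) a : nonneg_sum p a -> has_sum p a.
Proof.
move=> pa; exists p, (fun=> 0), a, 0; split=> //.
- by split=> //; rewrite esum1.
- by move=> i /=; rewrite subr0.
- by rewrite subr0.
Qed.

(** Two decompositions [p - q = p' - q'] give [p + q' = p' + q], an equality of nonnegative
    families, whose sums agree. *)
Lemma has_sum_unique T (f : T -> R) s t : has_sum f s -> has_sum f t -> s = t.
Proof.
move=> [p [q [a [b [pa qb fE ->]]]]] [p' [q' [a' [b' [pa' qb' fE' ->]]]]].
suff : a + b' = a' + b by lra.
apply: nonneg_sum_unique (nonneg_sumD pa qb') _.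
apply: eq_nonneg_sum (nonneg_sumD pa' qb) => i /=.
by have := fE i; rewrite fE' /=; lra.
Qed.

Lemma has_sumB T (f g : T -> R) s t :
  has_sum f s -> has_sum g t -> has_sum (f \- g) (s - t).
Proof.
move=> [p [q [a [b [pa qb fE ->]]]]] [p' [q' [a' [b' [pa' qb' fE' ->]]]]].
exists (p \+ q'), (q \+ p'), (a + b'), (b + a'); split.
- exact: nonneg_sumD.
- exact: nonneg_sumD.
- by move=> i /=; rewrite fE fE' /=; lra.
- by lra.
Qed.

Lemma has_sumN T (f : T -> R) s : has_sum f s -> has_sum (\- f) (- s).
Proof.
move=> [p [q [a [b [pa qb fE ->]]]]]; exists q, p, b, a; split=> //.
  by move=> i /=; rewrite fE opprB.
by rewrite opprB.
Qed.

Lemma has_sumD T (f g : T -> R) s t :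
  has_sum f s -> has_sum g t -> has_sum (f \+ g) (s + t).
Proof.
move=> fs gt; rewrite -[t]opprK.
by apply: eq_has_sum (has_sumB fs (has_sumN gt)) => i /=; rewrite opprK.
Qed.

Lemma has_sum_reindex T U (e : T -> U) (f : U -> R) s :
  bijective e -> has_sum f s -> has_sum (f \o e) s.
Proof.
move=> be [p [q [a [b [pa qb fE ->]]]]]; exists (p \o e), (q \o e), a, b.
by split=> //; [exact: nonneg_sum_reindex|exact: nonneg_sum_reindex|move=> i /=].
Qed.

Lemma has_sum_odd T (e : T -> T) (f : T -> R) s :
  bijective e -> (forall i, f (e i) = - f i) -> has_sum f s -> has_sum f 0.
Proof.
move=> be fe fs; suff <- : s = 0 by [].
suff : s = - s by lra.
apply: has_sum_unique (has_sum_reindex be fs) _.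
by apply: eq_has_sum (has_sumN fs) => i /=; rewrite fe.
Qed.

Lemma has_sum_mul T U (f : T -> R) (g : U -> R) s t :
  has_sum f s -> has_sum g t ->
  has_sum (fun k : T * U => f k.1 * g k.2) (s * t).
Proof.
move=> [p [q [a [b [pa qb fE ->]]]]] [p' [q' [a' [b' [pa' qb' fE' ->]]]]].
(* Expanding [(p - q) * (p' - q')] and grouping terms by sign leaves a difference of two nonnegative
   families. *)
have := has_sumB
  (nonneg_has_sum (nonneg_sumD (nonneg_sum_mul pa pa') (nonneg_sum_mul qb qb')))
  (nonneg_has_sum (nonneg_sumD (nonneg_sum_mul pa qb') (nonneg_sum_mul qb pa'))).
have -> : a * a' + b * b' - (a * b' + b * a') = (a - b) * (a' - b') by ring.
by apply: eq_has_sum => k /=; rewrite fE fE' /=; ring.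
Qed.

Lemma dominated_nonneg_sums T (f p : T -> R) a :
  (forall i, `|f i| <= p i) -> nonneg_sum p a ->
  nonneg_sum f^\+ (fine (\esum_(i in [set: T]) (f^\+ i)%:E)) /\
  nonneg_sum f^\- (fine (\esum_(i in [set: T]) (f^\- i)%:E)).
Proof.
move=> fp pa; split; apply: nonneg_sum_le pa => i.
  rewrite funrpos_ge0 /=; apply: le_trans (fp i).
  by rewrite /funrpos ge_max normr_ge0 ler_norm.
rewrite funrneg_ge0 /=; apply: le_trans (fp i).
by rewrite /funrneg ge_max normr_ge0 -normrN ler_norm.
Qed.

Lemma dominated_has_sum T (f p : T -> R) a :
  (forall i, `|f i| <= p i) -> nonneg_sum p a -> has_sum f (ssum f).
Proof.
move=> fp pa; have [fP fN] := dominated_nonneg_sums fp pa.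
by eexists _, _, _, _; split; [exact: fP|exact: fN| |] => // i;
  rewrite -[in LHS](funrposBneg f).
Qed.

Lemma has_sum_dominated T (f : T -> R) s : has_sum f s ->
  exists p a, nonneg_sum p a /\ forall i, `|f i| <= p i.
Proof.
move=> [p [q [a [b [pa qb fE _]]]]]; exists (p \+ q), (a + b).
split=> [|i]; first exact: nonneg_sumD.
rewrite fE /=; apply: le_trans (ler_normB _ _) _.
by rewrite !ger0_norm//; [case: qb|case: pa].
Qed.

Lemma has_sum_ssum T (f : T -> R) s : has_sum f s -> s = ssum f.
Proof.
move=> fs; apply: (has_sum_unique fs).
by have [p [a [pa fp]]] := has_sum_dominated fs; exact: dominated_has_sum pa.
Qed.

Lemma has_sum_finType (I : finType) T (f : I -> T -> R) (s : I -> R) :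
  (forall i, has_sum (f i) (s i)) ->
  has_sum (fun k : I * T => f k.1 k.2) (\sum_i s i).
Proof.
(* The witnesses in [has_sum] exist for each [i] separately; the positive and negative parts of
   [f i] give a decomposition uniform in [i]. *)
move=> fs; have fpn i := let: ex_intro p (ex_intro a (conj pa fp)) :=
  has_sum_dominated (fs i) in dominated_nonneg_sums fp pa.
exists (fun k : I * T => (f k.1)^\+ k.2), (fun k : I * T => (f k.1)^\- k.2).
eexists _, _; split.
- apply: (nonneg_sum_pair (fun i => (fpn i).1)); apply: nonneg_sum_finType => i.
  exact: nonneg_sum_ge0 (fpn i).1.
- apply: (nonneg_sum_pair (fun i => (fpn i).2)); apply: nonneg_sum_finType => i.
  exact: nonneg_sum_ge0 (fpn i).2.
- by move=> [i j] /=; rewrite -[in LHS](funrposBneg (f i)).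
- by rewrite -sumrB; apply: eq_bigr => i _; rewrite (has_sum_ssum (fs i)).
Qed.

End Sums.

(** * The inner product and the parallelogram law for Gaussian weights *)

Section DotProduct.
Context {R : realType} {n : nat}.
Implicit Types x y z : 'rV[R]_n.

Lemma dotvDl x y z : dotv (x + y) z = dotv x z + dotv y z.
Proof.
by rewrite /dotv -big_split; apply: eq_bigr => i _; rewrite !mxE mulrDl.
Qed.

Lemma dotvNl x z : dotv (- x) z = - dotv x z.
Proof. by rewrite /dotv -sumrN; apply: eq_bigr => i _; rewrite !mxE mulNr. Qed.

Lemma dotvC x y : dotv x y = dotv y x.
Proof. by apply: eq_bigr => i _; rewrite mulrC. Qed.

Lemma dotvDr x y z : dotv z (x + y) = dotv z x + dotv z y.
Proof. by rewrite dotvC dotvDl !(dotvC z). Qed.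

Lemma dotvNr x z : dotv z (- x) = - dotv z x.
Proof. by rewrite dotvC dotvNl dotvC. Qed.

Lemma dotv0 x : dotv x 0 = 0.
Proof. by apply: big1 => i _; rewrite mxE mulr0. Qed.

Lemma rhoE x : rho x = expR (- pi * dotv x x).
Proof. by rewrite /rho sqr_sqrtr// dotv_ge0. Qed.

Lemma rhoN x : rho (- x) = rho x.
Proof. by rewrite !rhoE dotvNl dotvNr opprK. Qed.

Lemma rho_le1 x : rho x <= 1.
Proof.
by rewrite rhoE -expR0 ler_expR mulNr oppr_le0 mulr_ge0 ?dotv_ge0 ?pi_ge0.
Qed.

Lemma scale_half_double x : 2^-1 *: (x + x) = x.
Proof. by rewrite scalerDr -scalerDl -[RHS]scale1r; congr (_ *: _); field. Qed.

Lemma half_sum_diffD x y : 2^-1 *: (x + y) + 2^-1 *: (x - y) = x.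
Proof. by rewrite -scalerDr addrACA subrr addr0 scale_half_double. Qed.

Lemma half_sum_diffB x y : 2^-1 *: (x + y) - 2^-1 *: (x - y) = y.
Proof. by rewrite -scalerBr opprB addrC addrA subrK scale_half_double. Qed.

Lemma rho_parallelogram x y : rho (x + y) * rho (x - y) = rho x ^+ 2 * rho y ^+ 2.
Proof.
rewrite !rhoE -!expRM_natl -!expRD !(dotvDl, dotvDr, dotvNl, dotvNr).
by rewrite (dotvC y x); congr expR; ring.
Qed.

End DotProduct.

(** Coordinates in a basis identify the lattice with a countable group on which parity can be read
    coordinatewise. *)
Lemma lattice_coordinates (R : realType) (n : nat) (L : lattice R n) :
  exists u : {ffun 'I_n -> int} -> 'rV[R]_n,
    [/\ {morph u : c d / c - d}, injective u & lattice_set L = range u].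
Proof.
have [B rB LE] := lattice_setP L.
exists (fun c => \sum_(i < n) (c i)%:~R *: row i B); split.
- move=> c d; rewrite -sumrB; apply: eq_bigr => i _.
  by rewrite !ffunE intrB scalerBl.
- move=> c d E; apply/ffunP => i.
  have : \row_j (c j)%:~R = \row_j (d j)%:~R :> 'rV[R]_n.
    apply: (row_free_inj rB); rewrite !mulmx_sum_row.
    under eq_bigr => j _ do rewrite mxE.
    by under [RHS]eq_bigr => j _ do rewrite mxE.
  by move=> /rowP/(_ i); rewrite !mxE => /intr_inj.
- rewrite LE; apply/seteqP; split=> [_ [c _ <-]|_ [c _ <-]]; last by exists c.
  by exists (finfun c) => //; apply: eq_bigr => i _; rewrite ffunE.
Qed.

(** * Pairs of integer vectors sorted by parity class *)

Section ParityClasses.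
Context {n : nat}.
Notation Zn := {ffun 'I_n -> int}.

(** The 0/1 vectors represent the classes of [Zn] modulo 2, hence those of L/2L. *)
Definition parity_rep (e : {ffun 'I_n -> bool}) : Zn := [ffun i => (e i : nat)%:Z].

(* Pairs (v, w) are in bijection with pairs (v + w, v - w) of vectors congruent
   modulo 2, that is (e + 2 a, e + 2 b) for a unique parity class e. *)
Definition parity_pair (k : {ffun 'I_n -> bool} * (Zn * Zn)) : Zn * Zn :=
  (parity_rep k.1 + k.2.1 + k.2.2, k.2.1 - k.2.2).

Lemma parity_pair_bij : bijective parity_pair.
Proof.
rewrite -setTT_bijective; split=> //.
  move=> [e [a b]] [e' [a' b']] _ _ [] /ffunP E /ffunP E'.
  have H i : [/\ e i = e' i, a i = a' i & b i = b' i].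
    have := E i; have := E' i; rewrite !ffunE.
    by case: (e i) (e' i) => -[] /= => H1 H2; split=> //; try lia; exfalso; lia.
  by congr (_, (_, _)); apply/ffunP => i; have [] := H i.
move=> [v w] _.
(* Euclidean division by 2 of each coordinate of [v + w]: the remainder gives the class [e], the
   quotient gives [a]. *)
have H (s : int) : exists eb : bool * int, s = (eb.1 : nat)%:Z + eb.2 + eb.2.
  exists (odd `|s|%N, (s %/ 2)%Z) => /=.
  have := divz_eq s 2; have := modz_ge0 s (isT : 2 != 0 :> int).
  have := ltz_pmod s (isT : 0 < 2 :> int).
  by lia.
have /fin_all_exists[f fE] : forall i, exists eb : bool * int,
  v i + w i = (eb.1 : nat)%:Z + eb.2 + eb.2 by move=> i; exact: H.
(* The second component [a - b = w] forces [b = a - w]. *)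
exists ([ffun i => (f i).1], ([ffun i => (f i).2], [ffun i => (f i).2 - w i])) => //.
rewrite /parity_pair /=; congr (_, _); apply/ffunP => i; rewrite !ffunE.
  by rewrite addrA -fE addrK.
by rewrite opprB addrC subrK.
Qed.

End ParityClasses.

(** * Product decompositions of the Gaussian and cosine sums over L *)

Section LatticeSums.
Context {R : realType} {n : nat} (L : lattice R n).
Notation Zn := {ffun 'I_n -> int}.
Variable u : Zn -> 'rV[R]_n.
Hypotheses (uB : {morph u : c d / c - d}) (u_inj : injective u)
  (Lu : lattice_set L = range u).

Let uN : {morph u : c / - c}.
Proof.
by move=> c; have := uB 0 0; rewrite !subrr => u0; rewrite -[- c]sub0r uB u0 sub0r.
Qed.

Let uD : {morph u : c d / c + d}.
Proof. by move=> c d; rewrite -{1}[d]opprK uB uN opprK. Qed.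

Lemma rho_translate_sum x :
  nonneg_sum (fun c => rho (u c + x)) (rho_set (translate L x)).
Proof.
split=> [c|]; first exact: rho_ge0.
rewrite /rho_set fineK; last first.
  rewrite ge0_fin_numE ?rho_translate_fin//.
  by apply: esum_ge0 => w _; rewrite lee_fin rho_ge0.
suff -> : translate L x = [set u c + x | c in [set: Zn]]%classic.
  by rewrite esum_image// => c d _ _ /addIr /u_inj.
apply/seteqP; split=> [_ [w + <-]|_ [c _ <-]].
  by rewrite Lu => -[c _ <-]; exists c.
by exists (u c) => //; rewrite Lu; exists c.
Qed.

Lemma rho_lattice_sum : nonneg_sum (fun c => rho (u c)) (rho_set L).
Proof.
rewrite -[X in rho_set X]translate0.
by apply: eq_nonneg_sum (rho_translate_sum 0) => c; rewrite addr0.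
Qed.

Definition half_rep e : 'rV[R]_n := 2^-1 *: u (parity_rep e).

Lemma half_repD e : half_rep e + half_rep e = u (parity_rep e).
Proof. by rewrite -scalerDr scale_half_double. Qed.

(** Splitting the class representative evenly between [p] and [q] puts the pair in the form
    [(p + q, p - q)] to which [rho_parallelogram] applies. *)
Lemma parity_pairE k (p := u k.2.1 + half_rep k.1) (q := u k.2.2 + half_rep k.1) :
  u (parity_pair k).1 = p + q /\ u (parity_pair k).2 = p - q.
Proof.
rewrite /parity_pair /= uB !uD -half_repD; split.
  by rewrite /p /q addrACA addrC addrA.
by rewrite /p /q opprD addrACA subrr addr0.
Qed.

Lemma rho_sqr_translate_sum x :
  exists s, nonneg_sum (fun c => rho (u c + x) ^+ 2) s.
Proof.
eexists; apply: nonneg_sum_le (rho_translate_sum x) => c.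
by rewrite exprn_ge0 ?rho_ge0//= expr2 ler_piMl ?rho_ge0 ?rho_le1.
Qed.

Lemma rho_set_mul_decomposition :
  exists g : {ffun 'I_n -> bool} -> 'rV[R]_n -> R, forall x y,
    rho_set (translate L x) * rho_set (translate L y) =
    \sum_e g e (x + y) * g e (x - y).
Proof.
(* The shift is halved because [(x + y) / 2] plus or minus [(x - y) / 2] gives back [x] and [y]. *)
pose k e z c := rho (u c + (half_rep e + 2^-1 *: z)) ^+ 2.
have kE e z : has_sum (k e z) (ssum (k e z)).
  have [s ks] := rho_sqr_translate_sum (half_rep e + 2^-1 *: z).
  by rewrite -(has_sum_ssum (nonneg_has_sum ks)); exact: nonneg_has_sum.
exists (fun e z => ssum (k e z)) => x y.
have := has_sum_reindex parity_pair_bij (has_sum_mul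
  (nonneg_has_sum (rho_translate_sum x)) (nonneg_has_sum (rho_translate_sum y))).
move=> /has_sum_unique; apply.
apply: eq_has_sum (has_sum_finType
  (fun e => has_sum_mul (kE e (x + y)) (kE e (x - y)))) => t.
rewrite /k /= -rho_parallelogram; have [-> ->] := parity_pairE t.
congr (_ * _); congr rho.
  by rewrite !(addrA (u _)) addrACA half_sum_diffD.
by rewrite !(addrA (u _)) opprD addrACA half_sum_diffB.
Qed.

Lemma weighted_has_sum (T : choiceType) (p g : T -> R) a : (forall i, `|g i| <= 1) ->
  nonneg_sum p a -> has_sum (p \* g) (ssum (p \* g)).
Proof.
move=> g1 pa; apply: (dominated_has_sum _ pa) => i /=.
have p0 : 0 <= p i by case: pa.
by rewrite normrM ger0_norm// ler_piMr.
Qed.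

Definition cos_sum z := ssum (fun c => rho (u c) * cos (2 * pi * dotv (u c) z)).

Lemma cos_has_sum z :
  has_sum (fun c => rho (u c) * cos (2 * pi * dotv (u c) z)) (cos_sum z).
Proof. exact: weighted_has_sum (fun=> cos_max _) rho_lattice_sum. Qed.

(** The reflection [c |-> - c] preserves the weight and negates the sine. *)
Lemma sin_has_sum0 z :
  has_sum (fun c => rho (u c) * sin (2 * pi * dotv (u c) z)) 0.
Proof.
apply: (@has_sum_odd _ _ -%R) (weighted_has_sum (fun=> sin_max _) rho_lattice_sum).
  by apply: inv_bij; exact: opprK.
by move=> c /=; rewrite uN rhoN dotvNl mulrN sinN mulrN.
Qed.

(* The reflection c |-> - c - e preserves the coset of the class e, so that
   only the even part of the character contributes to its sum over the coset. *)
Lemma coset_sin_has_sum0 e z :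
  has_sum (fun c => rho (u c + half_rep e) ^+ 2 *
    sin (2 * pi * dotv (u c + half_rep e) z)) 0.
Proof.
have [s hs] := rho_sqr_translate_sum (half_rep e).
apply: (@has_sum_odd _ _ (fun c => - c - parity_rep e))
  (weighted_has_sum (fun=> sin_max _) hs).
  by apply: inv_bij => c; rewrite opprD !opprK addrK.
move=> c /=; rewrite uB uN -half_repD opprD addrA subrK -opprD.
by rewrite rhoN dotvNl mulrN sinN mulrN.
Qed.

Lemma cos_sum_mul_decomposition :
  exists g : {ffun 'I_n -> bool} -> 'rV[R]_n -> R, forall x y,
    cos_sum x * cos_sum y = \sum_e g e (x + y) * g e (x - y).
Proof.
pose k e z c := rho (u c + half_rep e) ^+ 2 *
  cos (2 * pi * dotv (u c + half_rep e) z).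
have kE e z : has_sum (k e z) (ssum (k e z)).
  have [s hs] := rho_sqr_translate_sum (half_rep e).
  exact: weighted_has_sum (fun=> cos_max _) hs.
exists (fun e z => ssum (k e z)) => x y.
(* Subtracting the product of sine sums, which is 0, turns the summand into the cosine of a single
   phase, which is additive in the pair of vectors. *)
have := has_sum_reindex parity_pair_bij (has_sumB
  (has_sum_mul (cos_has_sum x) (cos_has_sum y))
  (has_sum_mul (sin_has_sum0 x) (sin_has_sum0 y))).
rewrite mulr0 subr0 => /has_sum_unique; apply.
(* The term [0 * 0] makes room for the coset sine sums, so that the right-hand side also becomes the
   cosine of one phase. *)
rewrite [X in has_sum _ X](_ : _ = \sum_e
    (ssum (k e (x + y)) * ssum (k e (x - y)) - 0 * 0)); last first.
  by apply: eq_bigr => e _; rewrite mulr0 subr0.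
apply: eq_has_sum (has_sum_finType (fun e => has_sumB
  (has_sum_mul (kE e (x + y)) (kE e (x - y)))
  (has_sum_mul (coset_sin_has_sum0 e (x + y)) (coset_sin_has_sum0 e (x - y))))) => t.
rewrite /k /=; have [-> ->] := parity_pairE t.
move: (u _ + _) (u _ + _) => q p.
transitivity (rho p ^+ 2 * rho q ^+ 2 *
    cos (2 * pi * dotv p (x + y) + 2 * pi * dotv q (x - y))).
  by rewrite cosD; ring.
rewrite -rho_parallelogram.
(* Here [p + q] and [p - q] are the original pair, so this exchanges the two forms of the same
   phase. *)
have -> : 2 * pi * dotv p (x + y) + 2 * pi * dotv q (x - y) =
    2 * pi * dotv (p + q) x + 2 * pi * dotv (p - q) y.
  by rewrite !(dotvDl, dotvDr, dotvNl, dotvNr); ring.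
by rewrite cosD; ring.
Qed.

End LatticeSums.

(** * Expectations under the discrete Gaussian as sums over coordinates *)

Section Expectation.
Context {R : realType} {n : nat} (L : lattice R n).
Notation Zn := {ffun 'I_n -> int}.
Variable u : Zn -> 'rV[R]_n.
Hypotheses (u_inj : injective u) (Lu : lattice_set L = range u).

Local Open Scope ereal_scope.

Lemma esum_lattice_point (h : 'rV[R]_n -> \bar R) :
  \esum_(w in [set: lattice_point L]) h (lattice_vec w) =
  \esum_(c in [set: Zn]) h (u c).
Proof.
rewrite -(@esum_image _ _ _ _ (@lattice_vec _ _ L) h); last first.
  by move=> w w' _ _; exact: val_inj.
rewrite -(@esum_image _ _ _ _ u h); last by move=> c d _ _ /u_inj.
suff -> : [set lattice_vec w | w in [set: lattice_point L]]%classic = range u by [].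
rewrite -Lu; apply/seteqP; split=> [_ [w _ <-]|w Lw]; first exact/set_mem/(valP w).
by exists (exist _ w (mem_set Lw)).
Qed.

Lemma ge0_integral_discrete_gaussian (f : lattice_point L -> \bar R) :
  (forall w, 0 <= f w) ->
  \int[discrete_gaussian L]_w f w =
  \esum_(w in [set: lattice_point L])
    (f w * (rho (lattice_vec w) / rho_set L)%:E).
Proof.
move=> f0.
have w0 (w : lattice_point L) : 0 <= (rho (lattice_vec w) / rho_set L)%:E.
  by rewrite lee_fin divr_ge0 ?rho_ge0// ltW// rho_lattice_gt0.
(* Coding the coordinates by [pickle] cuts the space into countably many disjoint pieces, each empty
   (when [k] codes nothing) or a single point, so countable additivity of the integral applies. *)
pose F k : set (lattice_point L) :=
  [set w | exists2 c : Zn, pickle c = k & u c = lattice_vec w]%classic.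
have FT : (\bigcup_k F k = [set: lattice_point L])%classic.
  apply/seteqP; split=> // w _.
  have : range u (lattice_vec w) by rewrite -Lu; exact/set_mem/(valP w).
  by case=> c _ cw; exists (pickle c) => //; exists c.
have tF : trivIset [set: nat] F.
  move=> i j _ _ [w [[c <- cw] [d <- dw]]].
  by congr pickle; apply: u_inj; rewrite cw dw.
rewrite -FT ge0_integral_bigcup// nneseries_sum_bigcup//; last first.
  by move=> w; rewrite mule_ge0.
apply: eq_eseriesr => k _.
have [->|/set0P[w Fw]] := eqVneq (F k) set0.
  by rewrite integral_set0 esum_set0.
have -> : F k = [set w]%classic.
  apply/seteqP; split=> [w' [d dk dw']|_ ->//].
  case: Fw => c ck cw; apply: val_inj; rewrite -[LHS]dw' -[RHS]cw.
  by congr u; apply: (pcan_inj pickleK); rewrite dk.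
rewrite esum_set1; last by rewrite mule_ge0.
rewrite (eq_integral (cst (f w))); last by move=> w' /set_mem ->.
rewrite integral_cst//; congr (_ * _); exact: esum_set1.
Qed.

Lemma expectation_discrete_gaussian (g : 'rV[R]_n -> R) :
  (forall x, `|g x| <= 1)%R ->
  'E_(discrete_gaussian L)[fun w => g (lattice_vec w)] =
  (ssum (fun c => rho (u c) * g (u c)) / rho_set L)%:E.
Proof.
move=> g1; have L0 := rho_lattice_gt0 L.
have [] := @dominated_nonneg_sums _ _ (fun c => rho (u c) * g (u c))%R
  _ _ _ (rho_lattice_sum u_inj Lu).
  by move=> c; rewrite normrM ger0_norm ?rho_ge0// ler_piMr ?rho_ge0.
(* Stated for a general nonnegative [h] so as to serve for both the positive and the negative part
   of [g]. *)
have H (h r : 'rV[R]_n -> R) s : (forall x, 0 <= h x)%R ->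
    (forall x, rho x * h x = r x)%R -> nonneg_sum (fun c => r (u c)) s ->
    \int[discrete_gaussian L]_w (h (lattice_vec w))%:E = (s / rho_set L)%:E.
  move=> h0 hr [r0 rs]; rewrite ge0_integral_discrete_gaussian; last first.
    by move=> w; rewrite lee_fin.
  rewrite (@esum_lattice_point (fun x => (h x)%:E * (rho x / rho_set L)%:E)).
  rewrite mulrC EFinM -rs -esumZl ?invr_gt0//.
  by apply: eq_esum => c _; rewrite -!EFinM -hr; congr EFin; ring.
move=> sP sN; rewrite expectation.unlock integralE.
rewrite (funerpos (g \o @lattice_vec _ _ L)) (funerneg (g \o @lattice_vec _ _ L)).
(* A nonnegative weight commutes with taking positive and negative parts. *)
have rhoP x : (rho x * g^\+ x = (rho \* g)^\+ x)%R.
  by rewrite /funrpos maxr_pMr ?rho_ge0// mulr0.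
have rhoN x : (rho x * g^\- x = (rho \* g)^\- x)%R.
  by rewrite /funrneg maxr_pMr ?rho_ge0// mulr0 mulrN.
rewrite (H _ _ _ (funrpos_ge0 g) rhoP sP) (H _ _ _ (funrneg_ge0 g) rhoN sN).
by rewrite -EFinB -mulrBl.
Qed.

End Expectation.

(** * Derivation of the five inequalities from the two decompositions *)

Theorem corollary2p2 (R : realType) (n : nat) (L : lattice R n)
    (x y : 'rV[R]_n) :
  let f := periodic_gaussian L in
  let E (g : 'rV[R]_n -> R) :=
    ('E_(discrete_gaussian L) [fun w => g (lattice_vec w)])%E in
  let cosv (u w : 'rV[R]_n) := cos (2 * pi * dotv w u) in
  let sinv (u w : 'rV[R]_n) := sin (2 * pi * dotv w u) in
  [/\ f x ^+ 2 * f y ^+ 2 <= f (x + y) * f (x - y),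
      f x ^+ 4 <= f (2 *: x),
      f x * f y <= (f (x + y) + f (x - y)) / 2,
      (E (cosv x) ^+ 2 * E (cosv y) ^+ 2 <=
        E (fun w => cosv x w * cosv y w)%R ^+ 2 -
        E (fun w => sinv x w * sinv y w)%R ^+ 2)%E
    & (E (cosv x) * E (cosv y) <= E (fun w => cosv x w * cosv y w)%R)%E].
Proof.
move=> f E cosv sinv.
have [u [uB u_inj Lu]] := lattice_coordinates L.
have L0 := rho_lattice_gt0 L.
have [g gE] := rho_set_mul_decomposition uB u_inj Lu.
have [|fM0 fA0] := @normalized_parallelogram _ _ _
  (fun z => rho_set (translate L z)) _ _ gE; first by rewrite translate0.
have fM a b : f a ^+ 2 * f b ^+ 2 <= f (a + b) * f (a - b).
  by have := fM0 a b; rewrite translate0.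
have fA a b : f a * f b <= (f (a + b) + f (a - b)) / 2.
  by have := fA0 a b; rewrite translate0.
have f1 : f 0 = 1 by rewrite /f /periodic_gaussian translate0 divff// gt_eqF.
have [h hE] := cos_sum_mul_decomposition uB u_inj Lu.
have cos0 : cos_sum u 0 = rho_set L.
  apply: has_sum_unique (cos_has_sum u_inj Lu 0) _.
  apply: eq_has_sum (nonneg_has_sum (rho_lattice_sum u_inj Lu)) => c.
  by rewrite dotv0 mulr0 cos0 mulr1.
have [|cM cA] := normalized_parallelogram _ hE; first by rewrite cos0.
pose G z := cos_sum u z / rho_set L.
have GM a b : G a ^+ 2 * G b ^+ 2 <= G (a + b) * G (a - b).
  by have := cM a b; rewrite cos0.
have GA a b : G a * G b <= (G (a + b) + G (a - b)) / 2.
  by have := cA a b; rewrite cos0.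
have EE k : (forall z, `|k z| <= 1) ->
    E k = (ssum (fun c => rho (u c) * k (u c)) / rho_set L)%:E.
  exact: expectation_discrete_gaussian.
have Ecos z : E (cosv z) = (G z)%:E by rewrite EE// => w; exact: cos_max.
pose cc c := rho (u c) * (cosv x (u c) * cosv y (u c)).
pose ss c := rho (u c) * (sinv x (u c) * sinv y (u c)).
have Ecc : E (fun w => cosv x w * cosv y w) = (ssum cc / rho_set L)%:E.
  by rewrite EE// => w; rewrite normrM mulr_ile1 ?cos_max.
have Ess : E (fun w => sinv x w * sinv y w) = (ssum ss / rho_set L)%:E.
  by rewrite EE// => w; rewrite normrM mulr_ile1 ?sin_max.
have hcc : has_sum cc (ssum cc).
  apply: weighted_has_sum (rho_lattice_sum u_inj Lu) => c.
  by rewrite normrM mulr_ile1 ?cos_max.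
have hss : has_sum ss (ssum ss).
  apply: weighted_has_sum (rho_lattice_sum u_inj Lu) => c.
  by rewrite normrM mulr_ile1 ?sin_max.
(* The addition formulas express [G (x + y)] and [G (x - y)] as the cosine-product expectation minus
   and plus the sine-product expectation. *)
have GD : G (x + y) = ssum cc / rho_set L - ssum ss / rho_set L.
  rewrite -mulrBl; congr (_ / _).
  apply: has_sum_unique (cos_has_sum u_inj Lu _) _.
  apply: eq_has_sum (has_sumB hcc hss) => c.
  by rewrite dotvDr mulrDr cosD /cc /ss /cosv /sinv /=; ring.
have GB : G (x - y) = ssum cc / rho_set L + ssum ss / rho_set L.
  rewrite -mulrDl; congr (_ / _).
  apply: has_sum_unique (cos_has_sum u_inj Lu _) _.
  apply: eq_has_sum (has_sumD hcc hss) => c.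
  by rewrite dotvDr dotvNr mulrDr mulrN cosB /cc /ss /cosv /sinv /=; ring.
split.
- exact: fM.
(* This is (a) at [y = x], where the factor [f (x - x)] is 1. *)
- have : f x ^+ 2 * f x ^+ 2 <= f (x + x) * f (x - x) by exact: fM.
  by rewrite subrr f1 mulr1 -exprD scaler_nat mulr2n.
- exact: fA.
- rewrite !Ecos Ecc Ess -!EFin_expe -EFinM -EFinB lee_fin.
  (* The product [G (x + y) * G (x - y)] is a difference of squares. *)
  apply: le_trans (GM x y) _; rewrite GD GB.
  by rewrite le_eqVlt; apply/orP; left; apply/eqP; ring.
- rewrite !Ecos Ecc -EFinM lee_fin.
  (* The sine terms cancel in the mean of [G (x + y)] and [G (x - y)]. *)
  apply: le_trans (GA x y) _; rewrite GD GB.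
  by rewrite addrACA addNr addr0 mulrDl -splitr.
Qed.
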